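(* Let $K$ be a compact (Hausdorff) space and $D$ a dense subset of $K$. Then the following two conditions are equivalent: (i) $D$ is induced by a retractional skeleton in $K$. (ii) $D$ is countably compact and $(\mathcal{C}(K),\tau_p(D))$ is monotonically Sokolov.
   Context: All topological spaces are assumed to be Tychonoff. A retraction on $X$ is a continuous map $r:X\to X$ with $r\circ r=r$. $\mathcal{C}(K)$ is the set of continuous real-valued functions on $K$; for a dense set $D\subset K$, $\tau_p(D)$ is the topology of pointwise convergence on $D$, i.e. the weakest topology on $\mathcal{C}(K)$ such that $f\mapsto f(d)$ is continuous for every $d\in D$. Retractional skeleton: a retractional skeleton in a countably compact space $X$ is a family of continuous retractions $\mathfrak{s}=\{r_s\}_{s\in\Gamma}$ on $X$, indexed by an up-directed partially ordered set $\Gamma$, such that (i) $r_s[X]$ is a metrizable compact space for each $s\in\Gamma$; (ii) if $s\le t$ in $\Gamma$ then $r_s=r_s\circ r_t=r_t\circ r_s$; (iii) given $s_0<s_1<\cdots$ in $\Gamma$, $t=\sup_{n\in\omega}s_n$ exists in $\Gamma$ and $r_t(x)=\lim_{n\to\infty}r_{s_n}(x)$ for every $x\in X$; (iv) for every $x\in X$, $x=\lim_{s\in\Gamma}r_s(x)$. The set induced by $\mathfrak{s}$ in $X$ is $D(\mathfrak{s})=\bigcup_{s\in\Gamma}r_s[X]$; a set $D\subset X$ is induced by a retractional skeleton in $X$ if $D=D(\mathfrak{s})$ for some retractional skeleton $\mathfrak{s}$ in $X$. Monotonically Sokolov: a space $T$ is monotonically Sokolov if one can assign to every countable family $\mathcal{F}$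 of closed subsets of $T$ a continuous retraction $r_{\mathcal{F}}:T\to T$ and a countable external network $\mathcal{N}(\mathcal{F})$ of $r_{\mathcal{F}}(T)$ in $T$ such that $r_{\mathcal{F}}(F)\subset F$ for every $F\in\mathcal{F}$ and the assignment $\mathcal{N}$ is $\omega$-monotone. Here a family $\mathcal{N}$ of subsets of $T$ is an external network of $A\subset T$ in $T$ if for every $a\in A$ and every open $U\ni a$ there is $N\in\mathcal{N}$ with $a\in N\subset U$; and $\omega$-monotone means that $\mathcal{F}\subset\mathcal{G}$ implies $\mathcal{N}(\mathcal{F})\subset\mathcal{N}(\mathcal{G})$, and $\mathcal{N}(\bigcup_{n\in\omega}\mathcal{F}_n)=\bigcup_{n\in\omega}\mathcal{N}(\mathcal{F}_n)$ for every increasing sequence $(\mathcal{F}_n)_{n\in\omega}$ of countable families of closed subsets of $T$ (and all values of $\mathcal{N}$ are countable). *)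

(* Defs.v *)
From HB Require Import structures.
From mathcomp Require Import all_boot all_order all_algebra.
From mathcomp Require Import all_classical all_reals all_analysis.

Set Implicit Arguments.
Unset Strict Implicit.
Unset Printing Implicit Defensive.

Import Order.TTheory GRing.Theory Num.Theory.
Import numFieldNormedType.Exports.
Local Open Scope classical_set_scope.
Local Open Scope ring_scope.

Definition retraction (X : topologicalType) (r : X -> X) : Prop :=
  continuous r /\ r \o r = r.

Definition countably_compact (X : topologicalType) (A : set X) : Prop :=
  forall U : nat -> set X, (forall n, open (U n)) ->
    A `<=` cover [set: nat] U -> finite_subset_cover [set: nat] U A.

(* [m] is a metric structure on the carrier of [X] (with its own topology);
   it is required to induce the given topology of [X]. *)
Definition metrizable (R : realType) (X : topologicalType) : Prop :=
  exists m : Metric R X, forall x : X, nbhs x = @nbhs X (Metric.Pack m) x.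

(* The tails of a directed set: convergence along [tails Gamma] is convergence
   of nets indexed by [Gamma]. *)
Definition tails (d : Order.disp_t) (Gamma : porderType d) : set_system Gamma :=
  filter_from [set: Gamma] (fun s => [set t | (s <= t)%O]).
Arguments tails {d} Gamma _.

(* [set_type A] carries the subspace topology, so metrizability of the range of
   [r s] is metrizability as a subspace of [X]. *)
Record retractional_skeleton (R : realType) (X : topologicalType)
    (d : Order.disp_t) (Gamma : porderType d) (r : Gamma -> X -> X) : Prop :=
  RetractionalSkeleton {
    rskel_nonempty : [set: Gamma] !=set0 ;
    rskel_directed : forall s t : Gamma, exists u : Gamma,
      (s <= u)%O /\ (t <= u)%O ;
    rskel_retraction : forall s, retraction (r s) ;
    rskel_compact : forall s, compact (range (r s)) ;
    rskel_metrizable : forall s, metrizable R (set_type (range (r s))) ;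
    rskel_comp : forall s t : Gamma, (s <= t)%O ->
      r s = r s \o r t /\ r s = r t \o r s ;
    rskel_sup : forall s : nat -> Gamma, (forall n, (s n < s n.+1)%O) ->
      exists2 t : Gamma, supremums (range s) t &
        forall x, r (s n) x @[n --> \oo] --> r t x ;
    rskel_lim : forall x, r s x @[s --> tails Gamma] --> x
  }.

Definition induced_set (X : topologicalType) (d : Order.disp_t)
    (Gamma : porderType d) (r : Gamma -> X -> X) : set X :=
  \bigcup_(s in [set: Gamma]) range (r s).

Definition induced_by_retractional_skeleton (R : realType)
    (X : topologicalType) (D : set X) : Prop :=
  exists (d : Order.disp_t) (Gamma : porderType d) (r : Gamma -> X -> X),
    retractional_skeleton R r /\ D = induced_set r.

Definition external_network (T : topologicalType) (A : set T)
    (N : set (set T)) : Prop :=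
  forall (a : T) (U : set T), A a -> open U -> U a ->
    exists2 V, N V & V a /\ V `<=` U.

Definition countable_closed_family (T : topologicalType)
    (F : set (set T)) : Prop :=
  countable F /\ F `<=` closed.

(* An assignment on countable families of closed sets is represented by a total
   function, constrained only on such families. *)
Definition omega_monotone (T : topologicalType)
    (N : set (set T) -> set (set T)) : Prop :=
  [/\ forall F, countable_closed_family F -> countable (N F),
      forall F G, countable_closed_family F -> countable_closed_family G ->
        F `<=` G -> N F `<=` N G &
      forall F : nat -> set (set T),
        (forall n, countable_closed_family (F n)) ->
        (forall n, F n `<=` F n.+1) ->
        N (\bigcup_n F n) = \bigcup_n N (F n)].

Definition monotonically_sokolov (T : topologicalType) : Prop :=
  exists (r : set (set T) -> T -> T) (N : set (set T) -> set (set T)),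
    (forall F, countable_closed_family F ->
       [/\ retraction (r F),
           external_network (range (r F)) (N F) &
           forall A, F A -> r F @` A `<=` A]) /\
    omega_monotone N.

(* The continuous real functions on [K] with the topology of pointwise
   convergence on [D]: the coarsest topology making f |-> f d continuous for
   every d in [D], i.e. the supremum of the corresponding initial topologies. *)
Definition Cp_on (R : realType) (K : topologicalType) (D : set K) :
    topologicalType :=
  sup_topology (fun d : set_type D =>
    Topological.class
      (initial_topology (fun f : continuousType K R => f (set_val d) : R))).

(* Main.v *)
Require Import Defs.
From HB Require Import structures.
From mathcomp Require Import all_boot all_order all_algebra.
From mathcomp Require Import all_classical all_reals all_analysis.
From mathcomp Require Import finmap lra.

Set Implicit Arguments.
Unset Strict Implicit.
Unset Printing Implicit Defensive.

Import Order.TTheory GRing.Theory Num.Theory.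
Import numFieldNormedType.Exports.
Local Open Scope classical_set_scope.
Local Open Scope ring_scope.

(** Write T for C(K) with the topology of pointwise convergence on D.

    From a skeleton to the Sokolov property.  Each index s acts on T by the
    retraction f |-> f \o r_s, so to a countable family F of closed sets one
    wants to attach an index t(F) in an omega-monotone way.  Suprema of indices
    are not monotone enough, but countable directed sets of indices are: let
    hull(F) be the least set of indices containing a base point and closed under
    upper bounds and under witness functions phi(A, -, -) for A in F, and let
    t(F) be the supremum of hull(F).  Membership in hull(F) involves finitely
    many members of F only, hence hull commutes with increasing unions
    (hull_bigcup).  A point of the range of r_t is determined by its images
    under the r_s with s in hull(F), so by compactness a condition on
    f \o r_t near a point can be read off a basic set of one r_s[K]
    (approx_determined).  This gives the external network, made of the sets of
    functions mapping prescribed basic sets into prescribed rational intervals,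
    the basic sets being taken from countable bases of the r_s[K] with s in
    hull(F) (rho_network).  It also gives f \o r_t in A for f in A: otherwise
    finitely many basic sets and intervals isolate f \o r_t from A on points of
    D, and the witness functions let one take these points inside the range of
    r_t, where f and f \o r_t agree (rho_closed).

    From the Sokolov property to a skeleton.  For a countable A included in D,
    apply the property to the closed half-spaces of T given by the points of A.
    The resulting retraction does not change the values on the closure of A, so
    every behaviour on this closure is shown by some function at which the
    network is a local network (network_separates).  Choosing one function in
    each network element yields a countable set S(A) of functions separating
    the points of the closure of A, and S commutes with increasing unions
    (sokolov_separating).  Countable compactness of D forces the closure of A
    to lie in D (closure_countable_sub).  The indices of the skeleton are the
    countable sets E of points of D and functions on K such that S(A) is among
    the functions, for A the set of points of E, and such that finitely many
    functions of E take on A, up to any precision, all their joint values on K.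
    Then each x in K has exactly one companion y in the closure of A with
    f(y) = f(x) for every function f of E (exists_retract, index_separates);
    the retraction r_E sends x to y.  Uniqueness of y gives continuity, the
    commutation rules and, because S commutes with increasing unions, the
    behaviour at suprema; as the retractions of all larger indices preserve the
    functions of E, putting a Urysohn function into E gives convergence to the
    identity (exists_skeleton). *)

(** * Countable sets and closing off *)

Lemma countable_surj_nat (X : Type) (A : set X) :
  A !=set0 -> countable A -> exists2 e : nat -> X, forall n, A (e n) &
    forall x, A x -> exists n, e n = x.
Proof.
move=> [a Aa] /pfcard_geP[A0|[e]]; first by rewrite A0 in Aa.
exists e => [n|x Ax]; first exact: 'funS_e.
by have [n _ <-] := 'surj_e Ax; exists n.
Qed.

Lemma countable_setU (X : Type) (A B : set X) :
  countable A -> countable B -> countable (A `|` B).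
Proof.
by move=> cA cB; rewrite -bigcup2E; apply: bigcup_countable => // -[|[|n]] _.
Qed.

Lemma countable_image (X Y : Type) (f : X -> Y) (A : set X) :
  countable A -> countable (f @` A).
Proof. exact/sub_countable/card_image_le. Qed.

Lemma countable_seqs (X : eqType) (A : set X) :
  countable A -> countable [set l : seq X | forall x, x \in l -> A x].
Proof.
move=> cA; have [[a Aa]|A0] := pselect (A !=set0); last first.
  apply: (sub_countable (subset_card_le _) (countable1 [::])) => -[//|x l] /=.
  by move=> Al; exfalso; apply: A0; exists x; apply: Al; rewrite mem_head.
have [e eA surj_e] := countable_surj_nat (ex_intro _ a Aa) cA.
have /choice[h hK] : forall x, exists n, A x -> e n = x.
  move=> x; have [/surj_e[n <-]|nAx] := pselect (A x); first by exists n.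
  by exists 0%N.
apply: (@sub_countable _ _ _ (map e @` [set: seq nat])).
  apply: subset_card_le => l Al; exists (map h l) => //.
  rewrite -map_comp -[RHS]map_id; apply/eq_in_map => x /Al; exact: hK.
exact: countable_image.
Qed.

Lemma chain_le (X : Type) (E : nat -> set X) : (forall n, E n `<=` E n.+1) ->
  forall m n, (m <= n)%N -> E m `<=` E n.
Proof.
move=> incE m n /subnK <-; elim: (n - m)%N => [//|k IHk] x /IHk.
by rewrite addSn; exact: incE.
Qed.

Lemma chain_seq (X : eqType) (E : nat -> set X) (l : seq X) :
  (forall n, E n `<=` E n.+1) -> (forall x, x \in l -> (\bigcup_n E n) x) ->
  exists n, forall x, x \in l -> E n x.
Proof.
move=> incE; have leE := chain_le incE.
elim: l => [|a l IHl] lE; first by exists 0%N.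
have [|n nl] := IHl; first by move=> x xl; apply: lE; rewrite inE xl orbT.
have [m _ ma] := lE a (mem_head _ _).
exists (maxn m n) => x; rewrite inE => /orP[/eqP ->|/nl].
  exact: leE (leq_maxl _ _) _ ma.
exact: leE (leq_maxr _ _) x.
Qed.

Section Closing.
Context {X : Type} (step : set X -> set X).

(** Every stage keeps the previous one: a finite part of the closing then lies
    in a single stage, to which the step can be applied. *)
Definition closing_iter (A : set X) (k : nat) : set X :=
  iter k (fun E => E `|` step E) A.

Definition closing (A : set X) : set X := \bigcup_k closing_iter A k.

Lemma closing_sub A : A `<=` closing A.
Proof. by move=> x Ax; exists 0%N. Qed.

Lemma closing_countable A :
  (forall E, countable E -> countable (step E)) -> countable A ->
  countable (closing A).
Proof.
move=> cstep cA; apply: bigcup_countable => // k _.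
rewrite /closing_iter; elim: k => [//|k IHk] /=.
exact: countable_setU (cstep _ _).
Qed.

Lemma closing_iter_le A m n : (m <= n)%N ->
  closing_iter A m `<=` closing_iter A n.
Proof. by apply: chain_le => k x; left. Qed.

End Closing.

(** * Continuous functions on a compact space *)

Lemma compact_open_cover (X : topologicalType) (A : set X) :
  compact A -> cover_compact A.
Proof.
have [[a _] cA|A0 _ I J f _ _] := pselect (A !=set0); last first.
  by exists fset0 => // x Ax; exfalso; apply: A0; exists x.
(* A base point is needed to characterize compactness by open covers. *)
pose P : ptopologicalType := HB.pack (X : Type) (Topological.class X)
  (isPointed.Build X a).
have : @compact P A by [].
by rewrite compact_cover.
Qed.

Section ContinuousFunctions.
Context {R : realType} {K : topologicalType}.

Lemma cfunP (u : K -> R) : continuous u ->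
  exists f : continuousType K R, forall x, f x = u x.
Proof. by move=> cu; exists (mkcts cu). Qed.

Lemma cluster_continuous (Y : topologicalType) (F : set_system K)
    (f : K -> Y) (z : K) (c : Y) : hausdorff_space Y -> Filter F ->
  cluster F z -> continuous f -> f @ F --> c -> f z = c.
Proof.
move=> hY FF clz cf fc; apply: hY => A B nA nB.
have [x [Bx Ax]] := clz _ _ (fc _ nB) (cf _ _ nA).
by exists (f x).
Qed.

Lemma cluster_closed (F : set_system K) (A : set K) (z : K) :
  closed A -> F A -> cluster F z -> A z.
Proof.
by move=> cA FA clz; apply: cA => B nB; exact: clz.
Qed.

Lemma cfun_open (f : continuousType K R) (W : set R) :
  open W -> open [set y | W (f y)].
Proof. by move=> oW; apply: open_comp => // y _; exact: cts_fun. Qed.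

Hypotheses (K_compact : compact [set: K]) (K_hausdorff : hausdorff_space K).

(** Continuity and convergence of retractions are obtained from this: it is
    enough to locate the cluster points, and these are known as soon as the
    values of enough continuous functions at them are. *)
Lemma compact_unique_cluster (F : set_system K) (y : K) : ProperFilter F ->
  (forall z, cluster F z -> z = y) -> F --> y.
Proof.
move=> PF Fy; have [z [_ clz]] := K_compact PF filterT.
apply: (compact_cluster_set1 K_hausdorff K_compact) => //; [exact: filterT..|].
apply/seteqP; split=> [x /Fy //|x ->]; by rewrite -(Fy _ clz).
Qed.

Lemma urysohn_point (x : K) (U : set K) : open U -> U x ->
  exists u : continuousType K R, u x = 0 /\ forall y, ~ U y -> u y = 1.
Proof.
move=> oU Ux.
have sep : uniform_separator [set x] (~` U).
  apply: (normal_completely_regular (R := R)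
    (compact_normal K_hausdorff K_compact) (hausdorff_accessible K_hausdorff)).
  - exact: open_closedC.
  - exact.
have /(uniform_separatorP (R := R))[f [cf _ f0 f1]] := sep.
have [u uE] := cfunP cf; exists u; rewrite uE; split.
  by apply: f0; exists x.
by move=> y nUy; rewrite uE; apply: f1; exists y.
Qed.

Lemma urysohn_points (x y : K) : x <> y ->
  exists u : continuousType K R, u x = 0 /\ u y = 1.
Proof.
move=> xy; have cy : closed [set y].
  exact/accessible_closed_set1/hausdorff_accessible.
have [|//|u [u0 u1]] := @urysohn_point x (~` [set y]);
  first exact: closed_openC.
by exists u; split=> //; apply: u1; apply.
Qed.

End ContinuousFunctions.

(** * The topology of pointwise convergence on a subset *)

Section PointwiseTopology.
Context {R : realType} {K : topologicalType} (D : set K).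
Local Notation T := (Cp_on R D).

Lemma Cp_eval_continuous (d : K) : D d ->
  continuous ((fun h : continuousType K R => h d) : T -> R).
Proof.
move=> /mem_set Dd f.
have : nbhs (f : T) --> (f : T) by [].
move=> /cvg_sup /(_ (exist _ d Dd)) H A nA; apply: H.
by apply: (initial_continuous (f := fun g : continuousType K R => g d)).
Qed.

Lemma Cp_eval_open (d : K) (W : set R) : D d -> open W ->
  open ([set g | W ((g : continuousType K R) d)] : set T).
Proof.
move=> Dd oW; apply: (open_comp (f := fun g : T =>
  (g : continuousType K R) d)) => //.
by move=> g _; exact: (Cp_eval_continuous Dd).
Qed.

Lemma Cp_eval_closed (d : K) (W : set R) : D d -> closed W ->
  closed ([set g | W ((g : continuousType K R) d)] : set T).
Proof.
move=> Dd /closed_openC oW; rewrite -[X in closed X]setCK.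
by apply: open_closedC; exact: (Cp_eval_open Dd oW).
Qed.

(** The sets [U] with this property form a filter, which converges to [g] in
    the initial topology of each evaluation at a point of [D], hence in their
    supremum. *)
Lemma Cp_nbhsP (g : T) (U : set T) : nbhs g U ->
  exists (ds : seq K) (e : R), [/\ 0 < e, forall d, d \in ds -> D d &
    forall h : T, (forall d, d \in ds ->
      `|(h : continuousType K R) d - (g : continuousType K R) d| < e) -> U h].
Proof.
pose F : set_system T := [set V : set T |
  exists (ds : seq K) (e : R), [/\ 0 < e, forall d, d \in ds -> D d &
    forall h : T, (forall d, d \in ds ->
      `|(h : continuousType K R) d - (g : continuousType K R) d| < e) -> V h]].
have FF : Filter F.
  split.
  - by exists [::], 1; split.
  - move=> A B [dA [eA [A0 DA HA]]] [dB [eB [B0 DB HB]]].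
    exists (dA ++ dB), (Num.min eA eB); split; first by rewrite lt_min A0.
      by move=> d; rewrite mem_cat => /orP[/DA|/DB].
    move=> h Hh; split; [apply: HA|apply: HB] => d din;
    by have := Hh d; rewrite mem_cat din ?orbT lt_min => /(_ isT) /andP[].
  - move=> A B AB [ds [e [e0 DA HA]]]; exists ds, e; split=> // h /HA;
    exact: AB.
suff : F --> g by exact.
apply/cvg_sup => -[d Dd] V /= [W [[B oB <-] Bg BV]].
have /nbhs_ballP[e /= e0 eB] : nbhs (g d) B by exact: open_nbhs_nbhs.
exists [:: d], e; split=> //.
  by move=> x; rewrite inE => /eqP ->; exact: set_mem.
move=> h /(_ d); rewrite mem_head => /(_ isT) Hd; apply: BV; apply: eB.
by rewrite /ball /= distrC.
Qed.

Lemma Cp_continuous (phi : T -> T) :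
  (forall d, D d -> continuous
    (fun h : T => (phi h : continuousType K R) d : R)) ->
  continuous phi.
Proof.
move=> H g; apply/cvg_sup; first exact/fmap_filter/nbhs_filter.
move=> -[d Dd] V /= [W [[B oB <-] Bg BV]].
have HB := H d (set_mem Dd) g B (open_nbhs_nbhs (conj oB Bg)).
by apply: (@filterS _ (nbhs g) _ _ _ _ HB) => h /= Bh; apply: BV.
Qed.

End PointwiseTopology.

(** * Metrizability from countably many separating functions *)

(** Stated for a bare choice type, so that a metric can be built on the carrier
    of a space and be compared with the topology already there. *)
Lemma distance_metric (R : realType) (X : choiceType) (dist : X -> X -> R) :
  (forall x, dist x x = 0) -> (forall x y, dist x y = 0 -> x = y) ->
  (forall x y, dist x y = dist y x) ->
  (forall y x z, dist x z <= dist x y + dist y z) ->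
  exists m : Metric R X, forall x (V : set X),
    @nbhs X (Metric.Pack m) x V <->
    exists2 e, 0 < e & forall y, dist x y < e -> V y.
Proof.
case: X dist => X cX dist d0 dpos dsym dtri.
pose metric_of_dist := isMetric.Build R (Choice.Pack cX) d0 dpos dsym dtri.
pose M : metricType R := HB.pack X cX metric_of_dist.
exists (Metric.class M) => x V; rewrite -(@filter_from_ballE R M).
by split=> -[e e0 eV]; exists e => //= y /eV.
Qed.

Section CountableSeparation.
Context {R : realType} {K : topologicalType}.
Variables (f : nat -> continuousType K R) (L : set K).
Hypothesis L_compact : compact L.
Hypothesis f_separates : forall x y, L x -> L y ->
  (forall n, f n x = f n y) -> x = y.

(** Truncating at 1/(n+1) keeps the supremum of the gaps a distance and leaves
    only finitely many functions to control at a given scale. *)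
Definition trunc_gap (n : nat) (x y : K) : R :=
  Num.min `|f n x - f n y| n.+1%:R^-1.

Definition sup_gap (x y : K) : R := sup (range (fun n => trunc_gap n x y)).

Lemma trunc_gap_le1 n x y : trunc_gap n x y <= 1.
Proof. by rewrite ge_min invf_le1 ?ler1n ?orbT. Qed.

Lemma trunc_gap_ge0 n x y : 0 <= trunc_gap n x y.
Proof. by rewrite le_min normr_ge0 invr_ge0 ler0n. Qed.

Lemma trunc_gap_sup n x y : trunc_gap n x y <= sup_gap x y.
Proof.
apply: ub_le_sup; last by exists n.
by exists 1 => _ [m _ <-]; exact: trunc_gap_le1.
Qed.

Lemma sup_gap_le x y e : (forall n, trunc_gap n x y <= e) -> sup_gap x y <= e.
Proof.
by move=> le; apply: ge_sup => [|_ [n _ <-]//]; exists (trunc_gap 0 x y), 0%N.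
Qed.

Lemma sup_gap_triangle y x z : sup_gap x z <= sup_gap x y + sup_gap y z.
Proof.
apply: sup_gap_le => n.
apply: le_trans (lerD (trunc_gap_sup n x y) (trunc_gap_sup n y z)).
rewrite /trunc_gap; set c := _^-1.
have c0 : 0 <= c by rewrite invr_ge0 ler0n.
have tri := ler_distD (f n y) (f n x) (f n z).
have := normr_ge0 (f n x - f n y); have := normr_ge0 (f n y - f n z).
move: tri; set a := `|_|; set b := `|_|; set u := `|_| => abu b0 u0.
by rewrite /Num.min; case: ifP => ?; case: ifP => ?; case: ifP => ?; lra.
Qed.

(** Gaps with 1/(n+1) < e/2 are small everywhere, and each of the finitely many
    others is small near [x]. *)
Lemma sup_gap_nbhs x e : 0 < e -> nbhs x (fun y => sup_gap x y < e).
Proof.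
move=> e0; have e20 : 0 < e / 2 by lra.
have [N] := ltr_add_invr e20.
rewrite add0r => Ne.
have : nbhs x (fun y => forall n, (n < N)%N -> `|f n x - f n y| < e / 2).
  elim: N {Ne} => [|N IHN]; first exact: filterE.
  have fN : nbhs x (fun y => `|f N x - f N y| < e / 2).
    by have /cvgr_dist_lt := @cts_fun _ _ (f N) x; apply.
  apply: filterS2 IHN fN => y Hy fy n; rewrite ltnS leq_eqVlt.
  move=> /orP[/eqP -> //|].
  exact: Hy.
apply: filterS => y Hy; apply: (@le_lt_trans _ _ (e / 2)); last by lra.
apply: sup_gap_le => n; rewrite ge_min; case: (ltnP n N) => [/Hy/ltW -> //|Nn].
apply/orP; right; apply: le_trans (ltW Ne).
by rewrite lef_pV2 ?posrE ?ltr0n// ler_nat.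
Qed.

(** Some gap to [x] is bounded below near each point of [L] outside an open
    neighbourhood of [x]; compactness makes the bound uniform. *)
Lemma sup_gap_refines x (V : set K) : L x -> nbhs x V ->
  exists2 e, 0 < e & forall y, L y -> sup_gap x y < e -> V y.
Proof.
move=> Lx nV.
move: nV; rewrite nbhsE => -[W [oW Wx] WV].
have gap_pos z : L z -> ~ W z ->
    exists n (c : R), 0 < c /\ nbhs z (fun z' => c <= trunc_gap n x z').
  move=> Lz nWz; have [n fxz] : exists n, f n x <> f n z.
    apply: contrapT => nn; apply: nWz; rewrite -(f_separates Lx Lz) // => n.
    by apply: contrapT => fxz; apply: nn; exists n.
  have a0 : 0 < `|f n x - f n z| by rewrite normr_gt0 subr_eq0; apply/eqP.
  exists n, (Num.min (`|f n x - f n z| / 2) n.+1%:R^-1); split.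
    by rewrite lt_min invr_gt0 ltr0n andbT; lra.
  have a20 : 0 < `|f n x - f n z| / 2 by lra.
  have /cvgr_dist_lt/(_ _ a20) := @cts_fun _ _ (f n) z; apply: filterS.
  move=> z' fz'.
  rewrite le_min !ge_min lexx orbT andbT; apply/orP; left.
  by have := ler_distD (f n z') (f n x) (f n z); rewrite (distrC (f n z')); lra.
have cover : \forall e \near 0^'+, forall z, L z -> ~ W z -> e <= sup_gap x z.
  have : near_covering_within L by
    apply/near_covering_withinP/compact_near_coveringP.
  apply=> z Lz; have [Wz|nWz] := pselect (W z).
    exists (W, setT); first by split; [exact: open_nbhs_nbhs|exact: filterT].
    by move=> [z' e] /= [Wz' _] _ /(_ Wz').
  have [n [c [c0 cz]]] := gap_pos z Lz nWz.
  exists ([set z' | c <= trunc_gap n x z'], [set e : R | e <= c]).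
    by split=> //; exact: nbhs_right_le.
  move=> [z' e] /= [cz' ec] _ _.
  exact: le_trans ec (le_trans cz' (trunc_gap_sup n x z')).
near (0 : R)^'+ => e; exists e => //.
move=> y Ly ye; apply: WV; apply: contrapT => nWy.
suff : e <= sup_gap x y by rewrite leNgt ye.
by move: y Ly nWy {ye}; near: e.
Unshelve. all: by end_near. Qed.

Lemma compact_separated_metrizable : metrizable R (set_type L).
Proof.
pose dist (x y : set_type L) := sup_gap (set_val x) (set_val y).
have Lval (x : set_type L) : L (set_val x) by exact: set_mem (valP x).
have gapC x y : sup_gap x y = sup_gap y x.
  congr sup; apply/seteqP; split=> _ [n _ <-]; exists n;
    rewrite // /trunc_gap distrC //.
have [m mP] : exists m : Metric R (set_type L), forall x (V : set (set_type L)),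
    @nbhs _ (Metric.Pack m) x V <->
    exists2 e, 0 < e & forall y, dist x y < e -> V y.
  apply: distance_metric => [x|x y xy|x y|y x z].
  - apply/eqP; rewrite eq_le.
    rewrite (le_trans (trunc_gap_ge0 0 _ _) (trunc_gap_sup 0 _ _)) andbT.
    apply: sup_gap_le => n;
      by rewrite /trunc_gap subrr normr0 ge_min lexx.
  - apply/val_inj; apply: f_separates; [exact: Lval..|] => n.
    have := trunc_gap_sup n (set_val x) (set_val y); rewrite -/(dist x y) xy.
    rewrite /trunc_gap ge_min invr_le0 lern0 orbF normr_le0 subr_eq0 => /eqP.
    exact.
  - exact: gapC.
  - exact: sup_gap_triangle.
exists m => x; apply/seteqP; split=> V.
  move=> [_ /= [[W oW <-] Wx WV]]; apply/mP.
  have [e e0 eW] := sup_gap_refines (Lval x) (open_nbhs_nbhs (conj oW Wx)).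
  by exists e => // y xy; apply: WV; exact: eW.
move=> /mP[e e0 eV].
have : nbhs (set_val x) (fun y => sup_gap (set_val x) y < e) :=
  sup_gap_nbhs _ e0.
rewrite nbhsE => -[W [oW Wx] We].
by exists (set_val @^-1` W); split=> [| |y /We /eV]//; exists W.
Qed.

End CountableSeparation.

(** * Countable sets of indices of a skeleton *)

Section SkeletonIndices.
Context {R : realType} {K : topologicalType}.
Context {d : Order.disp_t} {Gamma : porderType d} {r : Gamma -> K -> K}.
Hypothesis K_hausdorff : hausdorff_space K.
Hypothesis skel : retractional_skeleton R r.

Lemma rskel_continuous s : continuous (r s).
Proof. by have [] := rskel_retraction skel s. Qed.

Lemma rskel_idem s x : r s (r s x) = r s x.
Proof. by have [_ /(congr1 (@^~ x))] := rskel_retraction skel s. Qed.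

Lemma rskel_le_inner (s t : Gamma) x : (s <= t)%O -> r s (r t x) = r s x.
Proof. by move=> /(rskel_comp skel)[/(congr1 (@^~ x)) /= <-]. Qed.

Lemma rskel_le_outer (s t : Gamma) x : (s <= t)%O -> r t (r s x) = r s x.
Proof. by move=> /(rskel_comp skel)[_ /(congr1 (@^~ x)) /= <-]. Qed.

Lemma induced_fixed x : induced_set r x -> exists s, r s x = x.
Proof. by move=> [s _ [y _ <-]]; exists s; rewrite rskel_idem. Qed.

Lemma induced_range s x : induced_set r (r s x).
Proof. by exists s. Qed.

Definition order_directed (M : set Gamma) :=
  M !=set0 /\
  forall s t, M s -> M t -> exists u, [/\ M u, (s <= u)%O & (t <= u)%O].

(** Stands for [t] being the supremum of [M]: as [r t] is then the pointwise
    limit of the [r s], its values are determined by theirs. *)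
Definition determines (M : set Gamma) (t : Gamma) :=
  (forall s, M s -> (s <= t)%O) /\
  forall x y, (forall s, M s -> r s x = r s y) -> r t x = r t y.

(** A skeleton has suprema of strictly increasing sequences only.  A directed
    set without greatest element contains a strictly increasing cofinal
    sequence, and a greatest element is its own supremum. *)
Lemma countable_directed_sup (M : set Gamma) :
  countable M -> order_directed M -> exists t, determines M t.
Proof.
move=> cM [M0 dirM].
have [[m [Mm maxm]]|nomax] :=
    pselect (exists m, M m /\ forall s, M s -> (s <= m)%O).
  by exists m; split=> // x y; apply.
have [e eM surj_e] := countable_surj_nat M0 cM.
have next (s : Gamma) n :
    exists u, M s -> [/\ M u, (s < u)%O & (e n <= u)%O].
  have [Ms|nMs] := pselect (M s); last by exists s.
  have [v Mv nvs] : exists2 v, M v & ~ (v <= s)%O.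
    apply: contrapT => nv; apply: nomax; exists s; split=> // v Mv.
    by apply: contrapT => nvs; apply: nv; exists v.
  have [u [Mu su vu]] := dirM _ _ Ms Mv.
  have [w [Mw uw ew]] := dirM _ _ Mu (eM n).
  exists w => _; split=> //; rewrite lt_def (le_trans su uw) andbT.
  by apply/eqP => ws; apply: nvs; rewrite -ws (le_trans vu).
have /choice[nx nxP] : forall p : Gamma * nat, exists u, M p.1 ->
    [/\ M u, (p.1 < u)%O & (e p.2 <= u)%O].
  by move=> [s n]; exact: next.
pose sq := fix sq n := if n is S k then nx (sq k, k) else e 0%N.
have sqM n : M (sq n).
  by elim: n => [|n IHn] //=; have [] := nxP (sq n, n) IHn.
have sq_lt n : (sq n < sq n.+1)%O by have [] := nxP (sq n, n) (sqM n).
have e_sq n : (e n <= sq n.+1)%O by have [] := nxP (sq n, n) (sqM n).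
have [t [ubt _] limt] := rskel_sup skel sq_lt.
exists t; split=> [s /surj_e[n <-]|x y rxy].
  by apply: le_trans (e_sq n) _; apply: ubt; exists n.+1.
apply: (cvg_unique K_hausdorff (limt x)).
rewrite (_ : (fun n => r (sq n) x) = (fun n => r (sq n) y)); first exact: limt.
by apply/funext => n; exact: rxy.
Qed.

Lemma finite_bound (I : eqType) (l : seq I) (P : I -> Gamma -> Prop) :
  (forall i, i \in l -> exists s, forall t, (s <= t)%O -> P i t) ->
  exists s, forall i, i \in l -> P i s.
Proof.
move=> lP; suff : exists s, forall t, (s <= t)%O -> forall i, i \in l -> P i t.
  by move=> [s Hs]; exists s; exact: Hs.
elim: l lP => [|i l IHl] lP.
  by have [s _] := rskel_nonempty skel; exists s.
have [|s Hs] := IHl; first by move=> j jl; apply: lP; rewrite inE jl orbT.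
have [s' Hs'] := lP i (mem_head _ _).
have [u [su s'u]] := rskel_directed skel s s'.
exists u => t ut j; rewrite inE => /orP[/eqP ->|];
  first exact/Hs'/(le_trans s'u).
exact/Hs/(le_trans su).
Qed.

(** The induced set is countably closed: indices fixing the terms of a sequence
    are dominated by an increasing sequence of indices, whose supremum fixes
    every term. *)
Lemma induced_seq_bound (x : nat -> K) : (forall n, induced_set r (x n)) ->
  exists t, forall n, r t (x n) = x n.
Proof.
move=> Dx; have /choice[s sP] n := induced_fixed (Dx n).
have /choice[ub ubP] : forall p : Gamma * Gamma, exists u,
    (p.1 <= u)%O /\ (p.2 <= u)%O.
  by move=> [a b]; exact: rskel_directed skel a b.
pose sq := fix sq n := if n is S k then ub (sq k, s n) else s 0%N.
have sq_le m n : (m <= n)%N -> (sq m <= sq n)%O.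
  move=> /subnK <-; elim: (n - m)%N => [//|k IHk]; rewrite addSn.
  by apply: le_trans IHk _; have [] := ubP (sq (k + m)%N, s (k + m).+1).
have s_sq n : (s n <= sq n)%O.
  by case: n => [//|n]; have [] := ubP (sq n, s n.+1).
have [||t [ubt _]] := @countable_directed_sup (range sq).
- exact: countable_image.
- split; first by exists (sq 0%N), 0%N.
  move=> _ _ [m _ <-] [n _ <-]; exists (sq (maxn m n)).
  by split; [exists (maxn m n)| |]; rewrite // sq_le ?leq_maxl ?leq_maxr.
- exists t => n; rewrite -[x n in LHS]sP rskel_le_outer //.
  by apply: le_trans (s_sq n) _; apply: ubt; exists n.
Qed.

(** If no finite subfamily covers, take [x n] outside the first [n] members.
    All these points lie in one range, which is compact and contained in the
    induced set, so finitely many members cover them. *)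
Lemma induced_countably_compact : countably_compact (induced_set r).
Proof.
move=> U oU coverU; apply: contrapT => nfin.
have /choice[x xP] n : exists x, induced_set r x /\
    forall i, (i < n)%N -> ~ U i x.
  apply: contrapT => nx; apply: nfin; exists [fset i | i in iota 0 n]%fset.
    by move=> i _; apply: mem_set.
  move=> y Dy; apply: contrapT => ncov; apply: nx; exists y;
    split=> // i lin Uy.
  apply: ncov; exists i => //=.
  by apply/imfsetP; exists i => //=; rewrite mem_iota.
have [t tP] := induced_seq_bound (fun n => (xP n).1).
have : compact (range (r t)) by apply: (rskel_compact skel).
move/compact_open_cover.
move=> /(_ nat [set: nat] U)[||F _ covF].
- by move=> i _; exact: oU.
- by move=> _ [y _ <-]; apply: coverU; exact: induced_range.
pose n := (\max_(i <- F) i).+1.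
have [i /= iF Ui] := covF (x n) (ex_intro2 _ _ _ I (tP n)).
by apply: ((xP n).2 i _ Ui); rewrite ltnS; exact: leq_bigmax_seq.
Qed.

End SkeletonIndices.
Arguments determines {K d Gamma} r M t.

(** * Countable bases *)

Lemma compact_pseudometric_base (R : realType) (T : pseudoMetricType R) :
  compact [set: T] -> @second_countable T.
Proof.
have [[a _] cT|T0 _] := pselect ([set: T] !=set0); last first.
  by exists set0 => //; split=> // x; exfalso; apply: T0; exists x.
pose P : pseudoPMetricType R :=
  HB.pack (T : Type) (PseudoMetric.class T) (isPointed.Build T a).
exact: (@compact_second_countable R P cT).
Qed.

Section MetrizableBase.
Context {R : realType} {K : topologicalType}.
Hypothesis K_compact : compact [set: K].

(** [B] enumerates the preimages of a countable base of the compact metric space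
    [range q], so it is through [q] that its members are small. *)
Lemma metrizable_range_base (q : K -> K) : continuous q ->
  metrizable R (set_type (range q)) ->
  exists B : nat -> set K, forall x V, open V -> V (q x) ->
    exists n, B n x /\ forall z, B n z -> V (q z).
Proof.
move=> cq [m nbhsm].
have [[x0]|K0] := pselect ([set: K] !=set0); last first.
  by exists (fun=> set0) => x; exfalso; apply: K0; exists x.
pose Y := set_type (range q).
pose co (x : K) : Y := exist _ (q x) (mem_set (ex_intro2 _ _ x I erefl)).
pose M := Metric.Pack m : metricType R.
have cco : continuous (co : K -> M).
  move=> x W; rewrite /nbhs /= => nW; have : nbhs (co x) W by rewrite nbhsm.
  move=> [_ /= [[V oV <-] Vx VW]].
  have nV := cq x V (open_nbhs_nbhs (conj oV Vx)).
  by apply: (@filterS _ (nbhs x) _ _ _ _ nV) => z Vz; exact: VW.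
have cM : compact [set: M].
  rewrite (_ : [set: M] = co @` [set: K]).
    by apply: continuous_compact => //; exact: continuous_subspaceT.
  apply/seteqP; split=> // -[y yq] _; have [x _ xy] := set_mem yq.
  by exists x => //; exact: eq_exist.
have [BB cBB [_ basisB]] := compact_pseudometric_base cM.
have [[W0 BW0]|B0] := pselect (BB !=set0); last first.
  have [W [BW _] _] := basisB (co x0) setT filterT.
  by exfalso; apply: B0; exists W.
have [e eB surj_e] := countable_surj_nat (ex_intro _ W0 BW0) cBB.
exists (fun n => co @^-1` (e n)) => x V oV Vx.
have nV : nbhs (co x : M) (fun y : M => V (set_val (y : Y))).
  have : nbhs (co x) (fun y : Y => V (set_val y)).
    by exists (set_val @^-1` V); split=> //; exists V.
  by rewrite nbhsm.
have [W [/surj_e[n <-] Wx] WV] := basisB _ _ nV.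
by exists n; split=> // z /WV.
Qed.

End MetrizableBase.

Lemma rat_interval (R : realType) (c e : R) : 0 < e ->
  exists p : rat * rat, (ratr p.1 < c < ratr p.2) /\
    forall z, ratr p.1 < z < ratr p.2 -> `|z - c| < e.
Proof.
move=> e0; have /rat_in_itvoo[a] : c - e < c by lra.
have /rat_in_itvoo[b] : c < c + e by lra.
rewrite !in_itv /= => /andP[b1 b2] /andP[a1 a2].
exists (a, b); split=> [|z /= /andP[z1 z2]]; first by rewrite a2 b1.
by rewrite ltr_distl; apply/andP; split; lra.
Qed.

(** * From a skeleton to the monotone Sokolov property *)

Section SkeletonToSokolov.
Context {R : realType} {K : topologicalType}.
Context {d : Order.disp_t} {Gamma : porderType d} {r : Gamma -> K -> K}.
Hypotheses (K_compact : compact [set: K]) (K_hausdorff : hausdorff_space K).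
Hypothesis skel : retractional_skeleton R r.
Variable B : Gamma -> nat -> set K.
Hypothesis B_base : forall s x V, open V -> V (r s x) ->
  exists n, B s n x /\ forall z, B s n z -> V (r s z).

Local Notation C := (continuousType K R).
Local Notation D := (induced_set r).
Local Notation T := (Cp_on R D).

(** The code [(n, p)] requires of a function that it map the basic set number
    [n] into the rational interval [p]. *)
Definition code : Type := (nat * (rat * rat))%type.

Definition in_rat_itv (p : rat * rat) (z : R) : Prop := ratr p.1 < z < ratr p.2.

Lemma in_rat_itv_open p : open (in_rat_itv p).
Proof.
rewrite (_ : in_rat_itv p = `]ratr p.1, ratr p.2[%classic);
  first exact: itv_open.
by apply/seteqP; split=> z; rewrite /= in_itv.
Qed.

(** The points of [r t] are separated by the [r s] with [s] in [M].  So for [s]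
    large in [M], the point [r s y] avoids the compact image under [r s] of the
    set [Z] where the condition on [f \o r t] fails, and a basic set around it
    can be chosen outside that image. *)
Lemma approx_determined (M : set Gamma) (t : Gamma) (f : C) (p : rat * rat)
    (y : K) : order_directed M -> determines r M t ->
  in_rat_itv p (f (r t y)) ->
  exists s, M s /\ forall s', M s' -> (s <= s')%O ->
    exists n, B s' n y /\ forall z, B s' n z -> in_rat_itv p (f (r t z)).
Proof.
move=> [[m0 Mm0] dirM] [ubM detM] fy.
pose Z := [set z | ~ in_rat_itv p (f (r t z))].
have cft : continuous (f \o r t).
  by move=> x; apply: continuous_comp;
    [exact: (rskel_continuous skel)|exact: cts_fun].
have Zcl : closed Z.
  rewrite (_ : Z = ~` ((f \o r t) @^-1` in_rat_itv p)) //; apply: open_closedC.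
  by apply: open_comp; [move=> x _; exact: cft|exact: in_rat_itv_open].
pose F := filter_from M (fun s => [set s' | M s' /\ (s <= s')%O]).
have FF : ProperFilter F.
  apply: filter_from_proper; last by move=> s Ms; exists s.
  apply: filter_from_filter; first by exists m0.
  move=> s s' Ms Ms'; have [u [Mu su s'u]] := dirM _ _ Ms Ms'.
  exists u => // v [Mv uv]; split; split=> //; exact: le_trans uv.
(* Separation from [y] by [r s] is an open condition that persists for larger
   indices, so compactness gives one [s] for all points of [Z]. *)
have : \forall s \near F, forall z, [set: K] z -> Z z -> r s z <> r s y.
  move/compact_near_coveringP: K_compact; apply=> z _.
  have [Zz|nZz] := pselect (Z z); last first.
    have nz : nbhs z (~` Z).
      by apply: open_nbhs_nbhs; split=> //; exact: closed_openC.
    exists (~` Z, setT) => [|[z' s] /= [nZ _] /nZ//].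
    by split=> //; exact: filterT.
  have [s [Ms rsz]] : exists s, M s /\ r s z <> r s y.
    apply: contrapT => ns; apply: Zz; rewrite (detM z y) // => s Ms.
    by apply: contrapT => rs; apply: ns; exists s.
  have nz : nbhs z (r s @^-1` (~` [set r s y])).
    apply: (rskel_continuous skel); apply: open_nbhs_nbhs; split=> //.
    exact/closed_openC/accessible_closed_set1/hausdorff_accessible.
  exists (r s @^-1` (~` [set r s y]), [set s' | M s' /\ (s <= s')%O]).
    by split=> //; exists s.
  move=> [z' s'] /= [ns [_ ss']] _ rs'; apply: ns.
  by rewrite -(rskel_le_inner skel z' ss') rs' (rskel_le_inner skel _ ss').
move=> [s Ms Hs]; exists s; split=> // s' Ms' ss'.
pose V := ~` (r s' @` Z).
have oV : open V.
  apply/closed_openC/(compact_closed K_hausdorff); apply: continuous_compact.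
    by apply: continuous_subspaceT; exact: (rskel_continuous skel).
  exact: (subclosed_compact Zcl K_compact).
have [|n [Bny BV]] := @B_base s' y V oV.
  by move=> [z Zz rzy]; apply: (Hs s' _ z I Zz rzy).
exists n; split=> // z /BV nV; apply: contrapT => Zz; apply: nV; by exists z.
Qed.

Lemma approx_determined_seq (M : set Gamma) (t : Gamma) (f : C)
    (ds : seq K) (e : R) : order_directed M -> determines r M t -> 0 < e ->
  exists (s : Gamma) (c : K -> code), M s /\ forall x, x \in ds ->
    [/\ B s (c x).1 x,
      forall z, B s (c x).1 z -> in_rat_itv (c x).2 (f (r t z)) &
      forall z, in_rat_itv (c x).2 z -> `|z - f (r t x)| < e].
Proof.
move=> dirM detM e0; have [[m0 Mm0] dir] := dirM.
have /choice[p pP] x := rat_interval (f (r t x)) e0.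
suff [s [Ms Hs]] : exists s, M s /\ forall x, x \in ds ->
    forall s', M s' -> (s <= s')%O ->
    exists n, B s' n x /\ forall z, B s' n z -> in_rat_itv (p x) (f (r t z)).
  have /choice[n nP] : forall x, exists n, x \in ds ->
      B s n x /\ forall z, B s n z -> in_rat_itv (p x) (f (r t z)).
    move=> x; have [xds|_] := boolP (x \in ds); last by exists 0%N.
    by have [n] := Hs x xds s Ms (lexx s); exists n.
  exists s, (fun x => (n x, p x)); split=> // x xds /=.
  by have [? ?] := nP x xds; split=> //; have [] := pP x.
elim: ds => [|x ds [s [Ms Hs]]]; first by exists m0.
have [s' [Ms' Hs']] := approx_determined dirM detM (pP x).1.
have [u [Mu su s'u]] := dir _ _ Ms Ms'.
exists u; split=> // y; rewrite inE => /orP[/eqP ->|yds] v Mv uv.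
- by apply: Hs' => //; exact: le_trans uv.
- by apply: Hs => //; exact: le_trans uv.
Qed.

(** [w] places the conditions of the list [l] at points of [D] and shows that,
    placed there, no member of [A] satisfies them. *)
Definition avoids (A : set T) (s : Gamma) (l : seq code) (w : seq (K * code)) :=
  [/\ map snd w = l, forall p, p \in w -> D p.1 /\ B s p.2.1 p.1 &
    forall g, A g -> exists2 p, p \in w & ~ in_rat_itv p.2.2 ((g : C) p.1)].

(** A failing placement involves finitely many points of [D], which a single
    index fixes. *)
Lemma avoids_fixed A s l : exists u, forall w, avoids A s l w ->
  exists w', avoids A s l w' /\ forall p, p \in w' -> r u p.1 = p.1.
Proof.
have [[w aw]|nw] := pselect (exists w, avoids A s l w); last first.
  by exists s => w aw; exfalso; apply: nw; exists w.
have [|u uw] := finite_bound skel (l := w) (P := fun p u => r u p.1 = p.1).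
  move=> p pw; have [_ /(_ p pw)[/(induced_fixed skel)[v rv] _] _] := aw.
  by exists v => v' vv'; rewrite -rv (rskel_le_outer skel).
by exists u => _ _; exists w.
Qed.

Variables (s0 : Gamma) (ub : Gamma -> Gamma -> Gamma).
Hypothesis ubP : forall s t, (s <= ub s t)%O /\ (t <= ub s t)%O.
Variable (phi : set T -> Gamma -> seq code -> Gamma).
Hypothesis phiP : forall A s l w, avoids A s l w ->
  exists w', avoids A s l w' /\ forall p, p \in w' -> r (phi A s l) p.1 = p.1.

(** Closure under [ub] makes the hull directed; closure under [phi A] puts a
    failing placement, if there is one, inside the range of the supremum. *)
Definition hull_step (F : set (set T)) (E : set Gamma) : set Gamma :=
  [set ub p.1 p.2 | p in E `*` E] `|`
  [set phi q.1.1 q.1.2 q.2 | q in (F `*` E) `*` [set: seq code]].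

Definition hull (F : set (set T)) : set Gamma := closing (hull_step F) [set s0].

Lemma hull_countable F : countable F -> countable (hull F).
Proof.
move=> cF; apply: closing_countable; last exact: countable1.
move=> E cE; apply: countable_setU; apply: countable_image.
  exact: countableX.
by apply: countableX; [exact: countableX|exact: countableP].
Qed.

Lemma hull_directed F : order_directed (hull F).
Proof.
split; first by exists s0; apply: closing_sub.
move=> s t [m _ Ms] [n _ Mt]; exists (ub s t); have [su tu] := ubP s t;
  split=> //.
exists (maxn m n).+1 => //; right; left; exists (s, t) => //; split=> /=.
  exact: closing_iter_le (leq_maxl _ _) _ Ms.
exact: closing_iter_le (leq_maxr _ _) _ Mt.
Qed.

Lemma hull_phi F A s l : F A -> hull F s -> hull F (phi A s l).
Proof.
by move=> FA [k _ Ms]; exists k.+1 => //; right; right; exists (A, s, l).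
Qed.

Lemma hull_subset (F G : set (set T)) : F `<=` G -> hull F `<=` hull G.
Proof.
move=> FG s [k _ Ms]; exists k => //; move: k s Ms.
elim=> [//|k IHk] s [/IHk|[[p [/IHk ? /IHk ?] <-]|]].
- by left.
- by right; left; exists p.
- move=> [[[A s'] l] [[/FG ? /IHk ?] _] <-].
  by right; right; exists (A, s', l).
Qed.

(** Each element of the hull is reached in finitely many steps, which use
    finitely many members of the union, all in one [F n]. *)
Lemma hull_bigcup (F : nat -> set (set T)) : (forall n, F n `<=` F n.+1) ->
  hull (\bigcup_n F n) = \bigcup_n hull (F n).
Proof.
move=> incF; have leF := chain_le incF.
apply/seteqP; split=> [s [k _ Ms]|s [n _]]; last first.
  by apply: hull_subset => A FA; exists n.
suff [n Mn] : exists n, closing_iter (hull_step (F n)) [set s0] k s.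
  by exists n => //; exists k.
have mono m n i : (m <= n)%N -> closing_iter (hull_step (F m)) [set s0] i `<=`
    closing_iter (hull_step (F n)) [set s0] i.
  move=> mn; elim: i => [//|i IHi] u [/IHi|[[p [/IHi ? /IHi ?] <-]|]].
  - by left.
  - by right; left; exists p.
  - move=> [[[A s'] l] [[/(leF m n mn) ? /IHi ?] _] <-].
    by right; right; exists (A, s', l).
elim: k s Ms => [|k IHk] s; first by exists 0%N.
move=> [/IHk[n Mn]|[[p [/IHk[m Mm] /IHk[n Mn]] <-]|]].
- by exists n; left.
- exists (maxn m n); right; left; exists p => //; split.
    exact: mono (leq_maxl _ _) _ Mm.
  exact: mono (leq_maxr _ _) _ Mn.
- move=> [[[A s'] l] [[[m _ Fm] /IHk[n Mn]] _] <-].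
  exists (maxn m n); right; right; exists (A, s', l) => //; split=> //;
    split=> /=.
    exact: leF (leq_maxl _ _) _ Fm.
  exact: mono (leq_maxr _ _) _ Mn.
Qed.

Definition box (s : Gamma) (l : seq code) : set T :=
  [set g : T | forall c, c \in l ->
    forall z, B s c.1 z -> in_rat_itv c.2 ((g : C) z)].

Definition boxes (M : set Gamma) : set (set T) :=
  [set box p.1 p.2 | p in M `*` [set: seq code]].

Section Retraction.
Variables (F : set (set T)) (t : Gamma) (rho : T -> T).
Hypothesis F_closed : F `<=` closed.
Hypothesis t_hull : determines r (hull F) t.
Hypothesis rhoE : forall (f : T) x, (rho f : C) x = (f : C) (r t x).

Lemma rho_retraction : retraction rho.
Proof.
split; last first.
  apply/funext => f; apply/continuousEP => x /=.
  by rewrite !rhoE (rskel_idem skel).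
apply: Cp_continuous => x _.
under eq_fun do rewrite rhoE.
exact/Cp_eval_continuous/induced_range.
Qed.

(** If [f \o r t] were outside the closed set [A], points [ds] of [D] and
    intervals around the values of [f \o r t] would witness it.  A basic set
    around each of these points, taken at an index of the hull, is mapped by
    [f \o r t] into the corresponding interval.  The placement of these
    conditions at [ds] fails for [A], so some placement [w'] at points fixed by
    [r t] fails too.  But at such points [f] agrees with [f \o r t], hence
    satisfies the conditions, although it belongs to [A]. *)
Lemma rho_closed (A : set T) : F A -> rho @` A `<=` A.
Proof.
move=> FA _ [f Af <-]; apply: contrapT => nA.
have /Cp_nbhsP[ds [e [e0 dsD He]]] : nbhs (rho f) (~` A).
  by apply: open_nbhs_nbhs; split=> //; apply: closed_openC; exact: F_closed.
have [s [c [Ms cP]]] :=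
  approx_determined_seq (f : C) ds (hull_directed F) t_hull e0.
pose w := [seq (x, c x) | x <- ds].
have aw : avoids A s (map snd w) w.
  split=> // [_ /mapP[x xds ->]|g Ag] /=.
    by have [Bx _ _] := cP x xds; split=> //; exact: dsD.
  apply: contrapT => navoid; apply: (He g _ Ag) => x xds.
  have [_ _ ce] := cP x xds; rewrite rhoE; apply: ce; apply: contrapT => ng.
  by apply: navoid; exists (x, c x) => //; apply/mapP; exists x.
have [w' [[w'w w'B w'A] rw']] := phiP aw.
have [p pw' np] := w'A f Af; apply: np.
have /mapP[[x cx] /mapP[x' xds [-> ->]] pE] : p.2 \in map snd w.
  by rewrite -w'w; apply/mapP; exists p.
have [_ Bc _] := cP x' xds; have [_ Bp] := w'B p pw'.
have rp : r t p.1 = p.1.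
  rewrite -[p.1 in LHS](rw' p pw') (rskel_le_outer skel) ?rw' //.
  exact/t_hull.1/hull_phi.
by rewrite pE /= in Bp *; have := Bc _ Bp; rewrite rp.
Qed.

(** The conditions found by [approx_determined_seq] hold for [f \o r t] on whole
    basic sets, so they define a box around it; the points [ds] belong to these
    basic sets, so the box is small. *)
Lemma rho_network : external_network (range rho) (boxes (hull F)).
Proof.
move=> _ U [f _ <-] oU Uf.
have /Cp_nbhsP[ds [e [e0 dsD He]]] : nbhs (rho f) U by exact: open_nbhs_nbhs.
have [s [c [Ms cP]]] :=
  approx_determined_seq (f : C) ds (hull_directed F) t_hull e0.
exists (box s (map c ds)); first by exists (s, map c ds).
split=> [_ /mapP[x xds ->] z Bz|g bg].
  by rewrite rhoE; have [_ + _] := cP x xds; apply.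
apply: He => x xds; have [Bx _ ce] := cP x xds; rewrite rhoE; apply: ce.
by apply: bg => //; exact: map_f.
Qed.

End Retraction.

Lemma skeleton_sokolov_of_data : monotonically_sokolov T.
Proof.
have tP F : countable F -> exists t, determines r (hull F) t.
  move=> cF; apply: (countable_directed_sup K_hausdorff skel).
    exact: hull_countable.
  exact: hull_directed.
have /choice[rho rhoP] : forall F : set (set T), exists rho : T -> T,
    countable F -> exists t, determines r (hull F) t /\
      forall (f : T) x, (rho f : C) x = (f : C) (r t x).
  move=> F; have [/tP[t tF]|nF] := pselect (countable F); last by exists id.
  have /choice[rho rhoE] : forall f : T, exists g : T,
      forall x, (g : C) x = (f : C) (r t x).
    move=> f; apply: cfunP => x; apply: continuous_comp; last exact: cts_fun.
    exact: (rskel_continuous skel).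
  by exists rho => _; exists t.
exists rho, (fun F => boxes (hull F)); split.
  move=> F [cF clF]; have [t [tF rhoE]] := rhoP F cF; split.
  - exact: rho_retraction rhoE.
  - exact: rho_network tF rhoE.
  - by move=> A; exact: rho_closed clF tF rhoE A.
split=> [F [cF _]|F G _ _ /hull_subset FG|F _ /hull_bigcup hF].
- by apply: countable_image; apply: countableX;
  [exact: hull_countable|exact: countableP].
- by move=> _ [[s l] [/FG ? _] <-]; exists (s, l).
- rewrite hF; apply/seteqP; split=> [_ [[s l] [[n _ Ms] _] <-]|].
    by exists n => //; exists (s, l).
  move=> _ [n _ [[s l] [Ms _] <-]].
  by exists (s, l) => //; split=> //; exists n.
Qed.

End SkeletonToSokolov.

Lemma skeleton_sokolov (R : realType) (K : topologicalType)
    (d : Order.disp_t) (Gamma : porderType d) (r : Gamma -> K -> K) :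
  compact [set: K] -> hausdorff_space K -> retractional_skeleton R r ->
  monotonically_sokolov (Cp_on R (induced_set r)).
Proof.
move=> cK hK skel.
have /choice[B BP] s := metrizable_range_base cK
  (rskel_continuous skel (s := s)) (rskel_metrizable skel s).
have [s0 _] := rskel_nonempty skel.
have /choice[ub ubP] : forall p : Gamma * Gamma, exists u,
    (p.1 <= u)%O /\ (p.2 <= u)%O.
  by move=> [a b]; exact: (rskel_directed skel a b).
have /choice[phi phiP] q :=
  avoids_fixed skel B q.1.1 q.1.2 q.2.
apply: (@skeleton_sokolov_of_data _ _ _ _ _ cK hK skel B BP s0
  (fun s t => ub (s, t)) (fun s t => ubP (s, t))
  (fun A s l => phi (A, s, l)) (fun A s l => phiP (A, s, l))).
Qed.

(** * From the monotone Sokolov property to countable sets of functions *)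

Section SokolovToFunctions.
Context {R : realType} {K : topologicalType} (D : set K).
Hypotheses (K_compact : compact [set: K]) (K_hausdorff : hausdorff_space K).
Hypothesis D_countably_compact : countably_compact D.
Local Notation C := (continuousType K R).
Local Notation T := (Cp_on R D).
Variables (rho : set (set T) -> T -> T) (N : set (set T) -> set (set T)).
Hypothesis rhoP : forall F, countable_closed_family F ->
  [/\ retraction (rho F), external_network (range (rho F)) (N F) &
    forall A, F A -> rho F @` A `<=` A].
Hypothesis N_monotone : omega_monotone N.

(** Preserving both kinds of half-spaces at [d], at all rational levels, means
    preserving the value at [d]. *)
Definition half_space (d : K) (q : rat) (b : bool) : set T :=
  if b then [set g : T | (g : C) d <= ratr q]
  else [set g : T | ratr q <= (g : C) d].

Definition half_spaces (A : set K) : set (set T) :=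
  [set half_space p.1.1 p.1.2 p.2 | p in A `*` [set: rat] `*` [set: bool]].

Lemma half_spaces_family A : countable A -> A `<=` D ->
  countable_closed_family (half_spaces A).
Proof.
move=> cA AD; split.
  apply: countable_image; do 2!apply: countableX => //; exact: countableP.
move=> _ [[[d q] b] [[/= /AD Dd _] _] <-]; rewrite /half_space.
case: b; [exact: (Cp_eval_closed Dd (@closed_le R (ratr q)))|
          exact: (Cp_eval_closed Dd (@closed_ge R (ratr q)))].
Qed.

Lemma half_spaces_bigcup (A : nat -> set K) :
  half_spaces (\bigcup_n A n) = \bigcup_n half_spaces (A n).
Proof.
apply/seteqP; split=> [_ [[[d q] b] [[/= [n _ And] _] _] <-]|].
  by exists n => //; exists (d, q, b).
by move=> _ [n _ [[[d q] b] [[/= Ad _] _] <-]]; exists (d, q, b) => //;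
  do !split=> //; exists n.
Qed.

Lemma rho_fixes A (u : T) d : countable A -> A `<=` D -> closure A d ->
  (rho (half_spaces A) u : C) d = (u : C) d.
Proof.
move=> cA AD clAd; have [_ _ inv] := rhoP (half_spaces_family cA AD).
set h : C := rho _ u.
have hA a : A a -> h a = (u : C) a.
  move=> Aa; apply/eqP; rewrite eq_le; apply/andP; split.
    rewrite leNgt; apply/negP => /rat_in_itvoo[q]; rewrite in_itv /= =>
      /andP[uq qh].
    have : half_space a q true h.
      apply: (inv _ _ h); first by exists (a, q, true).
      by exists u => //=; exact: ltW.
    by rewrite /half_space /= leNgt qh.
  rewrite leNgt; apply/negP => /rat_in_itvoo[q]; rewrite in_itv /= =>
    /andP[hq qu].
  have : half_space a q false h.
    apply: (inv _ _ h); first by exists (a, q, false).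
    by exists u => //=; exact: ltW.
  by rewrite /half_space /= leNgt hq.
have cz : closed [set x | h x - (u : C) x = 0].
  apply: (preimage_closed (f := fun x => h x - (u : C) x) (D := [set 0])).
    by move=> x _; apply: cvgB; exact: cts_fun.
  exact/accessible_closed_set1/hausdorff_accessible/Rhausdorff.
suff : [set x | h x - (u : C) x = 0] d.
  by move=> /= /eqP; rewrite subr_eq0 => /eqP.
rewrite ((closure_id _).1 cz); move: clAd; apply: closureS => x Ax /=.
by rewrite hA // subrr.
Qed.

(** The retraction changes [u] into a function of its range, without changing
    the values on the closure of [A]; the network is local at that function. *)
Lemma network_separates A (u : C) (W : set T) : countable A -> A `<=` D ->
  open W -> (forall h : C, {in closure A, h =1 u} -> W h) ->
  exists2 V, N (half_spaces A) V & V `<=` W /\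
    exists2 h : C, V h & {in closure A, h =1 u}.
Proof.
move=> cA AD oW HW; have [_ net _] := rhoP (half_spaces_family cA AD).
have eqh : {in closure A, (rho (half_spaces A) u : C) =1 u}.
  by move=> x /set_mem clx; exact: rho_fixes.
have [|V NV [Vh VW]] := net _ W _ oW (HW _ eqh); first by exists u.
by exists V => //; split=> //; exists (rho (half_spaces A) u).
Qed.

(** Let [x] be in the closure of [A] but not in [D].  Each [y] of [D] in this
    closure has a network element [V] all of whose members are below 1/2 at [y],
    and one of whose members, [h V], is 1 at [x].  The countably many open sets
    [h V < 1/2], together with the complement of the closure, cover [D].  A
    finite subcover would miss the points of [A] close enough to [x], where the
    finitely many functions [h V] exceed 1/2. *)
Lemma closure_countable_sub A : countable A -> A `<=` D -> closure A `<=` D.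
Proof.
move=> cA AD x clx; apply: contrapT => nDx.
pose F := half_spaces A.
have /choice[h hP] : forall V : set T, exists h : C,
    (exists2 g : C, V g & g x = 1) -> V h /\ h x = 1.
  move=> V; have [[g Vg g1]|ng] := pselect (exists2 g : C, V g & g x = 1).
    by exists g.
  by exists (mkcts (@cst_continuous K R 0)) => /ng.
pose P := [set V | N F V /\ exists2 g : C, V g & g x = 1].
have PD y : D y -> closure A y -> exists2 V, P V & h V y < 1/2.
  move=> Dy cly; have [|u [uy ux]] :=
      urysohn_points (R := R) K_compact K_hausdorff (x := y) (y := x).
    by move=> yx; apply: nDx; rewrite -yx.
  pose W : set T := [set g : T | (g : C) y < 1/2].
  have oW : open W.
    exact: (Cp_eval_open Dy (@open_lt R (1/2))).
  have [|V NV [VW [g Vg gu]]] := network_separates cA AD oW (u := u).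
    by move=> g gu; rewrite /W /= (gu y (mem_set cly)) uy; lra.
  have Pg : exists2 g : C, V g & g x = 1.
    by exists g => //; rewrite (gu x (mem_set clx)).
  by exists V => //; apply: VW; have [] := hP V Pg.
have [a Aa] : A !=set0 by have [y [Ay _]] := clx _ filterT; exists y.
have [V0 PV0 _] := PD a (AD _ Aa) (subset_closure Aa).
have cP : countable P.
  have [N_countable _ _] := N_monotone.
  apply: (sub_countable (subset_card_le _)
    (N_countable _ (half_spaces_family cA AD))).
  by move=> V [].
have [e eP surj_e] := countable_surj_nat (ex_intro _ V0 PV0) cP.
have hx n : h (e n) x = 1 by have [_ /hP[]] := eP n.
pose U n := if n is S m then [set y | h (e m) y < 1/2] else ~` closure A.
have oU n : open (U n).
  case: n => [|n] /=; first exact/closed_openC/closed_closure.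
  exact: (cfun_open (h (e n)) (@open_lt R (1/2))).
have [|F0 _ covF] := D_countably_compact oU.
  move=> y Dy; have [cly|ncly] := pselect (closure A y); last by exists 0%N.
  by have [V /surj_e[n <-] hy] := PD y Dy cly; exists n.+1.
pose G n := if n is S m then [set y | 1/2 < h (e m) y] else setT.
have nG : nbhs x (\bigcap_(n in [set` F0]) G n).
  apply: filter_bigI => -[|n] _; first exact: filterT.
  apply: open_nbhs_nbhs; split; last by rewrite /G /= hx; lra.
  exact: (cfun_open (h (e n)) (@open_gt R (1/2))).
have [b [Ab Gb]] := clx _ nG.
have [[|n] /= nF Un] := covF b (AD _ Ab).
  by apply: Un; exact: subset_closure.
by have := Gb n.+1 nF; rewrite /G /= ltNge (ltW Un).
Qed.

(** [S A] consists of one function of each network element for [A].  Any such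
    choice separates [y] from [z], because some network element has only
    members below 1/2 at [y] and above 1/2 at [z]; this uses continuity of the
    evaluations at [y] and [z], that is, that both points are in [D]. *)
Lemma sokolov_separating : exists S : set K -> set C,
  [/\ forall A, countable A -> countable (S A),
    forall A : nat -> set K, (forall n, countable (A n)) ->
      (forall n, A n `<=` D) -> (forall n, A n `<=` A n.+1) ->
      S (\bigcup_n A n) `<=` \bigcup_n S (A n) &
    forall A y z, countable A -> A `<=` D -> closure A y -> closure A z ->
      (forall f, S A f -> f y = f z) -> y = z].
Proof.
have [N_countable _ N_bigcup] := N_monotone.
have /choice[sel selP] : forall V : set T, exists g : C, V !=set0 -> V g.
  move=> V; have [[g Vg]|nV] := pselect (V !=set0); first by exists g.
  by exists (mkcts (@cst_continuous K R 0)) => /nV.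
exists (fun A => sel @` N (half_spaces (A `&` D))); split.
- move=> A cA; apply/countable_image/N_countable/half_spaces_family.
    by apply: (sub_countable (subset_card_le _) cA) => y [].
  by move=> y [].
- move=> A cA AD incA; rewrite setIidl; last by move=> y [n _] /AD.
  rewrite half_spaces_bigcup N_bigcup => [|n|n].
  + by move=> _ [V [n _ NV] <-]; exists n => //; exists V; rewrite ?setIidl.
  + exact: half_spaces_family.
  + by move=> _ [p [[Ap ?] ?] <-]; exists p => //; do !split=> //; exact: incA.
- move=> A y z cA AD cly clz; rewrite setIidl // => Syz; apply: contrapT => yz.
  have [u [uy uz]] := urysohn_points (R := R) K_compact K_hausdorff yz.
  have Dy := closure_countable_sub cA AD cly.
  have Dz := closure_countable_sub cA AD clz.
  pose W : set T :=
    [set g : T | (g : C) y < 1/2] `&` [set g : T | 1/2 < (g : C) z].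
  have oW : open W.
    apply: openI.
      exact: (Cp_eval_open Dy (@open_lt R (1/2))).
    exact: (Cp_eval_open Dz (@open_gt R (1/2))).
  have [|V NV [VW [g Vg _]]] := network_separates cA AD oW (u := u).
    by move=> g gu; split; rewrite /= gu; try exact: mem_set; rewrite ?uy ?uz;
      lra.
  have [/= sy sz] := VW _ (selP V (ex_intro _ g Vg)).
  have := Syz (sel V) (ex_intro2 _ _ V NV erefl).
  by move=> syz; have := lt_trans sy sz; rewrite syz ltxx.
Qed.

End SokolovToFunctions.

(** * Countable nets in a dense set *)

Section DenseNets.
Context {R : realType} {K : topologicalType} (D : set K).
Hypotheses (K_compact : compact [set: K]) (D_dense : dense D).
Local Notation C := (continuousType K R).

Lemma nbhs_seq_close (l : seq C) (x : K) (e : R) : 0 < e ->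
  nbhs x [set y | forall f, f \in l -> `|f y - f x| < e].
Proof.
move=> e0; elim: l => [|f l IHl]; first exact: filterE.
have /cvgr_dist_lt/(_ _ e0) cf := @cts_fun _ _ f x.
apply: filterS2 IHl cf => y ly fy g; rewrite inE => /orP[/eqP ->|];
  last exact: ly.
by rewrite distrC.
Qed.

(** For each precision, the sets where the functions of [l] are close to their
    values at some point of [D] cover [K]; finitely many of them suffice. *)
Lemma dense_countable_net (l : seq C) : exists c : set K,
  [/\ countable c, c `<=` D & forall x (e : R), 0 < e ->
    exists2 a, c a & forall f, f \in l -> `|f a - f x| < e].
Proof.
pose B n d := [set y | forall f, f \in l -> `|f y - f d| < n.+1%:R^-1].
have /choice[F FP] n : exists F : {fset K}, {subset F <= D} /\
    forall x, exists2 d, d \in F & B n d x.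
  have [| |F FD covF] :=
      compact_open_cover K_compact (D := D) (f := fun d => (B n d)°).
  - by move=> d _; exact: open_interior.
  - move=> x _; have n0 : 0 < n.+1%:R^-1 / 2 :> R by rewrite divr_gt0.
    have nx := nbhs_seq_close l x n0.
    have [d [dx Dd]] : (([set y | forall f, f \in l ->
        `|f y - f x| < n.+1%:R^-1 / 2])° `&` D) !=set0.
      by apply: D_dense; [exists x|exact: open_interior].
    exists d => //; apply: filterS nx => y yx f fl.
    have := interior_subset dx f fl; have := yx f fl.
    by have := ler_distD (f x) (f y) (f d); rewrite (distrC (f x) (f d));
      set q := _^-1; lra.
  - exists F; split=> // x; have [d Fd /interior_subset Bx] := covF x I.
    by exists d.
exists (\bigcup_n [set` F n]); split.
- by apply: bigcup_countable.
- by move=> y [n _ /= /((FP n).1)] /set_mem.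
- move=> x e e0; have [n] := ltr_add_invr e0; rewrite add0r => ne.
  have [d Fd Bd] := (FP n).2 x; exists d; first by exists n.
  by move=> f /Bd; rewrite distrC => /lt_trans; apply.
Qed.

End DenseNets.

(** * Sets ordered by inclusion *)

Section InclusionOrder.
Context {X : Type}.

Record family (P : set X -> Prop) :=
  Family { members : set X; familyP : P members }.

Variable P : set X -> Prop.

HB.instance Definition _ := gen_eqMixin (family P).
HB.instance Definition _ := gen_choiceMixin (family P).

Definition family_le (E F : family P) : bool := `[< members E `<=` members F >].

Lemma family_le_refl : reflexive family_le.
Proof. by move=> E; apply/asboolP. Qed.

Lemma family_le_anti : antisymmetric family_le.
Proof.
move=> [E PE] [F PF] /andP[/asboolP/= EF /asboolP/= FE].
have EqF : E = F by apply/seteqP.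
by rewrite -EqF in PF *; congr Family; exact: Prop_irrelevance.
Qed.

Lemma family_le_trans : transitive family_le.
Proof.
by move=> E F G /asboolP FE /asboolP EG; apply/asboolP; exact: subset_trans EG.
Qed.

HB.instance Definition _ :=
  Order.Le_isPOrder.Build (Order.Disp tt tt) (family P)
    family_le_refl family_le_anti family_le_trans.

Lemma family_leP (E F : family P) :
  reflect (members E `<=` members F) (E <= F)%O.
Proof. exact: asboolP. Qed.

Lemma family_supremum (s : nat -> family P) (t : family P) :
  members t = \bigcup_n members (s n) -> supremums (range s) t.
Proof.
move=> tE; split=> [_ [n _ <-]|u ub]; apply/family_leP; rewrite tE.
  by move=> x snx; exists n.
move=> x [n _ sx].
by have /family_leP := ub (s n) (ex_intro2 _ _ n I erefl); apply.
Qed.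

End InclusionOrder.

(** * From countable sets of functions to a skeleton *)

Section FunctionsToSkeleton.
Context {R : realType} {K : topologicalType} (D : set K).
Hypotheses (K_compact : compact [set: K]) (K_hausdorff : hausdorff_space K).
Local Notation C := (continuousType K R).
Hypothesis closure_sub_D :
  forall A : set K, countable A -> A `<=` D -> closure A `<=` D.
Variables (S : set K -> set C) (net : seq C -> set K).
Hypothesis S_countable : forall A, countable A -> countable (S A).
Hypothesis S_bigcup : forall A : nat -> set K, (forall n, countable (A n)) ->
  (forall n, A n `<=` D) -> (forall n, A n `<=` A n.+1) ->
  S (\bigcup_n A n) `<=` \bigcup_n S (A n).
Hypothesis S_separates : forall A y z, countable A -> A `<=` D ->
  closure A y -> closure A z -> (forall f, S A f -> f y = f z) -> y = z.
Hypothesis netP : forall l, [/\ countable (net l), net l `<=` D &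
  forall x (e : R), 0 < e ->
    exists2 a, net l a & forall f, f \in l -> `|f a - f x| < e].

(** An index holds points of [K] and functions on [K] in one set, so that the
    order of indices is inclusion and suprema of chains are unions. *)
Definition points (E : set (K + C)) : set K := [set x | E (inl x)].
Definition functions (E : set (K + C)) : set C := [set f | E (inr f)].

(** The third condition makes the functions separate the closure of the points;
    the last one makes every point of [K] indistinguishable, by the functions,
    from some point of that closure. *)
Definition saturated (E : set (K + C)) : Prop :=
  [/\ countable E, points E `<=` D, S (points E) `<=` functions E &
    forall l : seq C, (forall f, f \in l -> functions E f) ->
      net l `<=` points E].

Lemma countable_points E : countable E -> countable (points E).
Proof.
move=> /countable_injP[i inj_i]; apply/countable_injP; exists (i \o inl).
move=> x y /set_mem Ex /set_mem Ey ixy.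
by have [] := inj_i (inl x) (inl y) (mem_set Ex) (mem_set Ey) ixy.
Qed.

Lemma countable_functions E : countable E -> countable (functions E).
Proof.
move=> /countable_injP[i inj_i]; apply/countable_injP; exists (i \o inr).
move=> x y /set_mem Ex /set_mem Ey ixy.
by have [] := inj_i (inr x) (inr y) (mem_set Ex) (mem_set Ey) ixy.
Qed.

(** The last two conditions concern one stage at a time: [S] commutes with
    increasing unions, and a finite list of functions lies in one stage.  This
    serves for the saturation of a set as well as for suprema of chains. *)
Lemma saturated_bigcup (E : nat -> set (K + C)) :
  (forall n, E n `<=` E n.+1) -> (forall n, countable (E n)) ->
  (forall n, points (E n) `<=` D) ->
  (forall n, S (points (E n)) `<=` functions (E n.+1)) ->
  (forall n (l : seq C), (forall f, f \in l -> functions (E n) f) ->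
     net l `<=` points (E n.+1)) ->
  saturated (\bigcup_n E n).
Proof.
move=> incE cE ED ES En; split.
- exact: bigcup_countable.
- by move=> x [n _ /ED].
- have -> : points (\bigcup_n E n) = \bigcup_n points (E n) by [].
  move=> f /S_bigcup[n|//|n x|n _ /ES ?]; last by exists n.+1.
    exact: countable_points.
  exact: incE.
- move=> l /chain_seq[n f /incE//|n /En nl] x /nl ?; by exists n.+1.
Qed.

Definition saturation_step (E : set (K + C)) : set (K + C) :=
  inr @` S (points E) `|`
  inl @` \bigcup_(l in [set l : seq C | forall f, f \in l -> functions E f])
    net l.

Lemma saturation E : countable E -> points E `<=` D ->
  exists2 E', saturated E' & E `<=` E'.
Proof.
move=> cE ED; exists (closing saturation_step E); last exact: closing_sub.
have cstep F : countable F -> countable (saturation_step F).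
  move=> cF; apply: countable_setU; apply: countable_image.
    exact/S_countable/countable_points.
  apply: bigcup_countable; first exact/countable_seqs/countable_functions.
  by move=> l _; have [] := netP l.
apply: saturated_bigcup => [n|n|n|n f Sf|n l ln x nx].
- by move=> x; left.
- rewrite /closing_iter; elim: n => [//|n IHn] /=.
  exact: countable_setU (cstep _ _).
- elim: n => [//|n IHn] x [/IHn//|[[//]|[y [l _ ly] [<-]]]].
  by have [_ lD _] := netP l; exact: lD.
- by right; left; exists f.
- by right; right; exists x => //; exists l.
Qed.

Local Notation index := (family saturated).

Lemma index_countable (E : index) : countable (points (members E)).
Proof. by have [cE _ _ _] := familyP E; exact: countable_points. Qed.

Lemma index_sub (E : index) : points (members E) `<=` D.
Proof. by have [] := familyP E. Qed.

Lemma index_separates (E : index) y z :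
  closure (points (members E)) y -> closure (points (members E)) z ->
  (forall f, functions (members E) f -> f y = f z) -> y = z.
Proof.
move=> cly clz Eyz; have [_ _ SE _] := familyP E.
by apply: S_separates cly clz _ => [||f /SE /Eyz//];
  [exact: index_countable|exact: index_sub].
Qed.

(** The points of [E] whose values under finitely many functions of [E] are
    close to those of [x] form a filter base; by compactness it has a cluster
    point, at which these functions take the same values as at [x]. *)
Lemma exists_retract (E : index) x : exists y,
  closure (points (members E)) y /\
  forall f, functions (members E) f -> f y = f x.
Proof.
pose dom := [set p : seq C * R |
  (forall f, f \in p.1 -> functions (members E) f) /\ 0 < p.2].
pose nearby (p : seq C * R) := points (members E) `&`
  [set a | forall f, f \in p.1 -> `|f a - f x| < p.2].
pose G := filter_from dom nearby.
have GF : ProperFilter G.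
  apply: filter_from_proper.
    apply: filter_from_filter; first by exists ([::], 1).
    move=> [l e] [l' e'] [/= lE e0] [/= lE' e0'].
    exists (l ++ l', Num.min e e').
      by split=> [f|] /=; [rewrite mem_cat => /orP[/lE|/lE']|rewrite lt_min e0].
    move=> a [Ea lea]; split; split=> //= f fl; have := lea f;
      by rewrite /= mem_cat fl ?orbT lt_min => /(_ isT) /andP[].
  move=> [l e] [/= lE e0]; have [_ _ dense_l] := netP l.
  have [a la ax] := dense_l x e e0; exists a; split=> //.
  by have [_ _ _ nE] := familyP E; exact: nE la.
have [y [_ clGy]] := K_compact GF filterT.
exists y; split.
  apply: (cluster_closed (@closed_closure _ _) _ clGy).
  exists ([::], 1) => //; move=> a [Ea _]; exact: subset_closure.
move=> f Ef; apply: (cluster_continuous _ _ clGy (@cts_fun _ _ f)).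
  exact: Rhausdorff.
apply/cvgrPdist_lt => e e0; exists ([:: f], e).
  by split=> // g /=; rewrite inE => /eqP ->.
by move=> a [_ /(_ f)] /=; rewrite mem_head distrC => /(_ isT).
Qed.

(** [r E x] is the only point of the closure of the points of [E] at which the
    functions of [E] take the same values as at [x].  Each clause of the
    definition of a skeleton reduces to this characterization. *)
Lemma exists_skeleton : induced_by_retractional_skeleton R D.
Proof.
have /choice[rr rrP] (p : index * K) := exists_retract p.1 p.2.
pose r (E : index) x := rr (E, x).
have r_closure E x : closure (points (members E)) (r E x).
  exact: (rrP (E, x)).1.
have r_fun E x f : functions (members E) f -> f (r E x) = f x.
  exact: (rrP (E, x)).2.
have r_unique E x y : closure (points (members E)) y ->
    (forall f, functions (members E) f -> f y = f x) -> r E x = y.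
  move=> cly fy; apply: (index_separates (r_closure E x) cly) => f Ef.
  by rewrite r_fun // fy.
have r_id E y : closure (points (members E)) y -> r E y = y.
  by move=> cly; exact: r_unique.
have r_range E : range (r E) = closure (points (members E)).
  by apply/seteqP; split=> [_ [x _ <-] //|y cly]; exists y; rewrite ?r_id.
have r_cont E : continuous (r E).
  move=> x; apply: (compact_unique_cluster K_compact K_hausdorff) => z clz.
  apply/esym/r_unique.
    apply: (cluster_closed (@closed_closure _ _) _ clz).
    by apply: (@filterE _ (nbhs x)) => y; exact: r_closure.
  move=> f Ef; apply: (cluster_continuous _ _ clz (@cts_fun _ _ f)).
    exact: Rhausdorff.
  have fr : f \o r E = f by apply/funext => y /=; rewrite r_fun.
  have cfr : continuous (f \o r E) by rewrite fr; exact: cts_fun.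
  by rewrite -(r_fun E x f Ef); exact: cfr.
(* [E] has fewer functions than [F], and [r F] preserves those of [F]. *)
have r_le_inner (E F : index) x : (E <= F)%O -> r E (r F x) = r E x.
  move=> /family_leP EF; apply: r_unique => // f Ef.
  by rewrite r_fun // r_fun //; exact: EF.
have r_le_outer (E F : index) x : (E <= F)%O -> r F (r E x) = r E x.
  move=> /family_leP EF; apply: r_id; apply: closureS (r_closure E x) => y.
  exact: EF.
have index_over (E : set (K + C)) : countable E -> points E `<=` D ->
    exists F : index, E `<=` members F.
  by move=> cE ED; have [F sF EF] := saturation cE ED; exists (Family sF).
exists (Order.Disp tt tt), index, r; split; last first.
  apply/seteqP; split=> [x Dx|x [E _]].
    have [||E xE] := @index_over [set inl x].
    - exact: countable1.
    - by move=> y [->].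
    exists E => //; rewrite r_range; apply: subset_closure; exact: xE.
  rewrite r_range; exact: (closure_sub_D (@index_countable E) (@index_sub E)).
split.
- have [|//|E _] := @index_over set0; first exact: countable0.
  by exists E.
- move=> E F; have [cE ED _ _] := familyP E; have [cF FD _ _] := familyP F.
  have [||G EFG] := @index_over (members E `|` members F).
  + exact: countable_setU.
  + by move=> x [/ED|/FD].
  by exists G; split; apply/family_leP => x ?; apply: EFG; [left|right].
- move=> E; split; first exact: r_cont.
  by apply/funext => x /=; rewrite r_le_inner.
- move=> E; rewrite r_range; apply: (subclosed_compact _ K_compact) => //.
  exact: closed_closure.
- move=> E; rewrite r_range.
  have [cE _ _ _] := familyP E.
  (* [g0] makes the set to be enumerated nonempty. *)
  pose g0 : C := mkcts (@cst_continuous K R 0).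
  have [||e eE surj_e] :=
      @countable_surj_nat _ (functions (members E) `|` [set g0]).
  + by exists g0; right.
  + by apply: countable_setU; [exact: countable_functions|exact: countable1].
  apply: (compact_separated_metrizable (f := e)).
    by apply: (subclosed_compact _ K_compact) => //; exact: closed_closure.
  move=> y z cly clz eyz; apply: (index_separates cly clz) => f Ef.
  by have [n <-] := surj_e f (or_introl Ef).
- move=> E F EF; split; apply/funext => x /=.
    by rewrite r_le_inner.
  by rewrite r_le_outer.
- move=> s s_lt.
  have inc n : members (s n) `<=` members (s n.+1).
    exact/family_leP/ltW.
  have satU : saturated (\bigcup_n members (s n)).
    apply: saturated_bigcup => // n; have [cE ED SE nE] := familyP (s n) => //.
      by move=> f /SE /inc.
    by move=> l /nE nl x /nl /inc.
  exists (Family satU); first exact: family_supremum.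
  move=> x; apply: (compact_unique_cluster K_compact K_hausdorff) => z clz.
  apply/esym/r_unique.
    apply: (cluster_closed (@closed_closure _ _) _ clz).
    exists 0%N => // n _ /=.
    by apply: closureS (r_closure (s n) x) => y Ey; exists n.
  move=> f [m _ mf]; have fc : f (r (s n) x) @[n --> \oo] --> f x.
    apply: cvg_near_cst; exists m => // n /= mn; apply: r_fun.
    exact: (chain_le inc mn).
  exact: (cluster_continuous (@Rhausdorff R) _ clz (@cts_fun _ _ f) fc).
- move=> x V; rewrite /= nbhsE => -[W [oW Wx] WV].
  (* All indices whose functions include [u] keep [x] inside [W]. *)
  have [u [ux uW]] := urysohn_point (R := R) K_compact K_hausdorff oW Wx.
  have [||E uE] := @index_over [set inr u].
  + exact: countable1.
  + by move=> y.
  exists E => // F /= /family_leP EF; apply: WV; apply: contrapT => /uW.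
  rewrite r_fun; last by apply/EF/uE.
  by rewrite ux => /esym/eqP; rewrite oner_eq0.
Qed.

End FunctionsToSkeleton.

(** * The equivalence *)

Theorem theorem1p4 (R : realType) (K : topologicalType) (D : set K)
    (K_compact : compact [set: K]) (K_hausdorff : hausdorff_space K)
    (D_dense : dense D) :
  induced_by_retractional_skeleton R D <->
  countably_compact D /\ monotonically_sokolov (Cp_on R D).
Proof.
split=> [[d [Gamma [r [skel ->]]]]|[cD [rho [N [rhoP N_monotone]]]]].
  split; first exact: (induced_countably_compact K_hausdorff skel).
  exact: skeleton_sokolov.
have [S [S_countable S_bigcup S_separates]] :=
  sokolov_separating K_compact K_hausdorff cD rhoP N_monotone.
have /choice[net netP] := dense_countable_net (R := R) K_compact D_dense.
apply: (exists_skeleton K_compact K_hausdorff _ S_countable S_bigcup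
  S_separates netP).
exact: (closure_countable_sub K_compact K_hausdorff cD rhoP N_monotone).
Qed.
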